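(* Let $D$ be a division ring, let $B = D[x_1,\dots,x_n]$ be the polynomial ring over $D$ in the commuting variables $x_1,\dots,x_n$, and let $M$ be a finitely generated right $B$-module. Then the following hold. (a) If $M$ is a torsion $B$-module, then there exists a change of variables $t_1,\dots,t_n$ of $x_1,\dots,x_n$, so that $B$ can also be written as a polynomial ring $B = D[t_1,\dots,t_n]$ in the new variables $t_i$, such that $M$ is a finitely generated $B_{n-1}$-module, where $B_{n-1} = D[t_1,\dots,t_{n-1}]$ is the polynomial ring in the fewer $n-1$ variables. (b) If, further, $M$ is a torsion $B_{n-1}$-module (with $t_i$ and $B_{n-1}$ as obtained in (a), and $n\ge 2$), then there exists a further change of variables $z_1,\dots,z_{n-1}$ of $t_1,\dots,t_{n-1}$ such that $B_{n-1} = D[z_1,\dots,z_{n-1}]$ and $M$ is a finitely generated $B_{n-2}$-module, where $B_{n-2} = D[z_1,\dots,z_{n-2}]$ is the polynomial ring in $n-2$ variables. Moreover, in this case $B$ can also be written as the polynomial ring $B = D[z_1,\dots,z_n]$, where $z_n$ can be chosen such that $z_n = t_n$.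
   Context: Rings are associative with identity, not necessarily commutative; modules are right modules. In a polynomial ring $R[x_1,\dots,x_n]$ the variables commute with each other and with the elements of $R$; a polynomial ring in zero variables over $D$ is $D$. A change of variables $t_1,\dots,t_n$ of $x_1,\dots,x_n$ means elements $t_1,\dots,t_n$ of $B = D[x_1,\dots,x_n]$ that commute with each other and with $D$, are algebraically independent over $D$, and satisfy $B = D[t_1,\dots,t_n]$. For a noetherian ring $R$, $C(0)$ denotes the set of regular elements (non-zero-divisors) of $R$. An element $y$ of an $R$-module $M$ is a torsion element if $yd=0$ for some $d\in C(0)$; $M$ is a torsion $R$-module if every element of $M$ is a torsion element. *)

(* Defs.v *)
From HB Require Import structures.
From mathcomp Require Import all_boot all_algebra.
From mathcomp Require Import mpoly.

Set Implicit Arguments.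
Unset Strict Implicit.
Unset Printing Implicit Defensive.

Import GRing.Theory.
Local Open Scope ring_scope.

Definition division_ring (D : unitRingType) : Prop :=
  forall a : D, a != 0 -> a \is a GRing.unit.

(* Subrings of B are given by their membership predicate B -> Prop. *)
Definition whole_ring (B : Type) : B -> Prop := fun=> True.
Arguments whole_ring B _ : clear implicits.

(* d lies in C(0) of the subring S: it is in S and is neither a left nor a
   right zero divisor among the elements of S. *)
Definition regular_in (B : nzRingType) (S : B -> Prop) (d : B) : Prop :=
  [/\ S d,
      forall b, S b -> d * b = 0 -> b = 0
    & forall b, S b -> b * d = 0 -> b = 0].

(* A right B-module is a left module over the converse ring B^c. *)
Definition ract (B : nzRingType) (M : lmodType B^c) (y : M) (b : B) : M :=
  (b : B^c) *: y.

Definition torsion_over (B : nzRingType) (M : lmodType B^c) (S : B -> Prop) :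
    Prop :=
  forall y : M, exists2 d : B, regular_in S d & ract y d = 0.

Definition fin_gen_over (B : nzRingType) (M : lmodType B^c) (S : B -> Prop) :
    Prop :=
  exists (k : nat) (g : 'I_k -> M), forall y : M,
    exists2 c : 'I_k -> B, (forall i, S (c i))
                         & y = \sum_(i < k) ract (g i) (c i).

(* The value at t of a polynomial with coefficients in D, the coefficients
   being written on the left of the monomials in t. *)
Definition eval_at (D : nzRingType) (n k : nat) (t : 'I_k -> {mpoly D[n]})
    (p : {mpoly D[k]}) : {mpoly D[n]} :=
  mmap (@mpolyC n D) t p.

(* D[t_1, ..., t_k]; this is the subring generated by D and the t_i when the
   t_i commute with each other and with D, the only case in which it is used. *)
Definition poly_subring (D : nzRingType) (n k : nat)
    (t : 'I_k -> {mpoly D[n]}) : {mpoly D[n]} -> Prop :=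
  fun b => exists p : {mpoly D[k]}, b = eval_at t p.

Definition alg_independent (D : nzRingType) (n k : nat)
    (t : 'I_k -> {mpoly D[n]}) : Prop :=
  forall p : {mpoly D[k]}, eval_at t p = 0 -> p = 0.

(* t_1, ..., t_k is a change of variables of the polynomial subring S, that is,
   of any k variables u_1, ..., u_k for which S = D[u_1, ..., u_k]. *)
Definition change_of_variables (D : nzRingType) (n k : nat)
    (S : {mpoly D[n]} -> Prop) (t : 'I_k -> {mpoly D[n]}) : Prop :=
  [/\ forall i, S (t i),
      forall i j, GRing.comm (t i) (t j),
      forall i (a : D), GRing.comm (t i) a%:MP,
      alg_independent t
    & forall b, S b <-> poly_subring t b].

(* (t_1, ..., t_k) |-> (t_1, ..., t_{k-1}) *)
Definition drop_last (T : Type) (k : nat) (t : 'I_k -> T) : 'I_k.-1 -> T :=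
  fun i => t (widen_ord (leq_pred k) i).

(* Main.v *)
(* Nagata's change of variables.  An element of D[x_1, ..., x_n] commuting with
   D is central, so substituting such elements is a ring morphism even though
   D is not commutative.  Each generator g of M is killed by some d <> 0.  With
   z_i = t_i - t_l ^ (r ^ (l - i)) for i < l and z_l = t_l, where l is the last
   index, the monomial t^m is monic in y = z_l over D[z_1, ..., z_{l-1}], of
   degree sum_i m_i r ^ (l - i).  If r exceeds every exponent in d, these
   degrees are the values of distinct base r expansions, so a single monomial
   of d dominates, and d times the inverse of its coefficient is monic in y.
   Hence finitely many g y^j generate M over D[z_1, ..., z_{l-1}].  For (b) the
   same shear is applied to t_1, ..., t_{n-1}, and it extends by t_n to a change
   of variables of the whole ring. *)

Require Import Defs.
From HB Require Import structures.
From mathcomp Require Import all_boot all_algebra.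
From mathcomp Require Import mpoly.
From mathcomp Require Import zify.

Set Implicit Arguments.
Unset Strict Implicit.
Unset Printing Implicit Defensive.

Import GRing.Theory.
Local Open Scope ring_scope.

(** * Evaluation of polynomials at central elements *)

Lemma comm_mpolyC_central (D : nzRingType) (n : nat) (t : {mpoly D[n]}) :
  (forall a : D, GRing.comm t a%:MP) -> forall x, GRing.comm x t.
Proof.
move=> tC x; rewrite [x]mpolyE; apply/commr_sym/commr_sum => m _.
rewrite -mul_mpolyC; apply: commrM; [exact: tC | exact: commr_mpolyX].
Qed.

Lemma eval_atD (D : nzRingType) (n k : nat) (t : 'I_k -> {mpoly D[n]}) :
  {morph eval_at t : p q / p + q}.
Proof. exact: mmapD. Qed.

Lemma eval_atB (D : nzRingType) (n k : nat) (t : 'I_k -> {mpoly D[n]}) :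
  {morph eval_at t : p q / p - q}.
Proof. exact: mmapB. Qed.

Lemma eval_at0 (D : nzRingType) (n k : nat) (t : 'I_k -> {mpoly D[n]}) :
  eval_at t 0 = 0.
Proof. exact: mmap0. Qed.

Lemma eval_atC (D : nzRingType) (n k : nat) (t : 'I_k -> {mpoly D[n]}) a :
  eval_at t a%:MP = a%:MP.
Proof. exact: mmapC. Qed.

Lemma eval_atX (D : nzRingType) (n k : nat) (t : 'I_k -> {mpoly D[n]}) i :
  eval_at t 'X_i = t i.
Proof. by rewrite /eval_at mmapX mmap1U. Qed.

Lemma eval_at_id (D : nzRingType) (n : nat) (p : {mpoly D[n]}) :
  eval_at (fun i => 'X_i) p = p.
Proof.
rewrite /eval_at /mmap [RHS]mpolyE; apply: eq_bigr => m _.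
by rewrite mmap1_id mul_mpolyC.
Qed.

Lemma eq_eval_at (D : nzRingType) (n k : nat) (s t : 'I_k -> {mpoly D[n]}) :
  s =1 t -> eval_at s =1 eval_at t.
Proof.
by move=> st p; apply: eq_bigr => m _; congr (_ * _); apply: mmap1_eq.
Qed.

Lemma eval_atM (D : nzRingType) (n k : nat) (t : 'I_k -> {mpoly D[n]}) :
  (forall i x, GRing.comm x (t i)) -> {morph eval_at t : p q / p * q}.
Proof.
move=> tC; have [||mulE _] := @commr_mmap_is_multiplicative k D _ t (@mpolyC n D).
- by move=> i x; apply: tC.
- by move=> p m m'; apply: commr_prod => i _; apply: commrX.
exact: mulE.
Qed.

Lemma eval_atXn (D : nzRingType) (n k : nat) (t : 'I_k -> {mpoly D[n]}) :
  (forall i x, GRing.comm x (t i)) ->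
  forall e p, eval_at t (p ^+ e) = eval_at t p ^+ e.
Proof.
move=> tC; elim=> [|e IH] p; first by rewrite !expr0 -mpolyC1 eval_atC.
by rewrite !exprS eval_atM ?IH.
Qed.

(** Centrality of the [t i] makes [eval_at t] multiplicative, so it passes through the coefficients
    and the ordered monomials in [s]. *)
Lemma eval_at_comp (D : nzRingType) (n k l : nat) (t : 'I_k -> {mpoly D[n]})
    (s : 'I_l -> {mpoly D[k]}) (p : {mpoly D[l]}) :
  (forall i x, GRing.comm x (t i)) ->
  eval_at t (eval_at s p) = eval_at (fun i => eval_at t (s i)) p.
Proof.
move=> tC; rewrite {2 3}/eval_at /mmap.
rewrite (big_morph _ (eval_atD t) (eval_at0 t)); apply: eq_bigr => m _.
rewrite eval_atM // eval_atC; congr (_ * _); rewrite /mmap1.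
rewrite (big_morph _ (eval_atM tC) (_ : eval_at t 1 = 1)); last first.
  by rewrite -mpolyC1 eval_atC.
by apply: eq_bigr => i _; rewrite eval_atXn.
Qed.

(** * Changes of variables, built from inverse substitutions *)

Lemma change_of_variables_central (D : nzRingType) (n k : nat)
    (S : {mpoly D[n]} -> Prop) (t : 'I_k -> {mpoly D[n]}) :
  change_of_variables S t -> forall i x, GRing.comm x (t i).
Proof. by case=> _ _ tC _ _ i; apply: comm_mpolyC_central. Qed.

Lemma change_of_variables_id (D : nzRingType) (n : nat) :
  change_of_variables (whole_ring {mpoly D[n]}) (fun i => 'X_i).
Proof.
split=> // [i j|i a|p|b].
- exact: commr_mpolyX.
- exact/commr_sym/commr_mpolyX.
- by rewrite eval_at_id.
- by split=> // _; exists b; rewrite eval_at_id.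
Qed.

(** [eval_at P] and [eval_at Q] are mutually inverse on [{mpoly D[k]}], so precomposing [eval_at t]
    with the former keeps its image and its injectivity. *)
Lemma change_of_variables_comp (D : nzRingType) (n k : nat)
    (S : {mpoly D[n]} -> Prop) (t : 'I_k -> {mpoly D[n]})
    (P Q : 'I_k -> {mpoly D[k]}) :
  change_of_variables S t ->
  (forall i x, GRing.comm x (P i)) -> (forall i x, GRing.comm x (Q i)) ->
  (forall i, eval_at P (Q i) = 'X_i) -> (forall i, eval_at Q (P i) = 'X_i) ->
  change_of_variables S (fun i => eval_at t (P i)).
Proof.
move=> tS PC QC PQ QP; have tC := change_of_variables_central tS.
case: tS => St _ _ tI tE.
have PQK p : eval_at P (eval_at Q p) = p.
  by rewrite eval_at_comp // (eq_eval_at PQ) eval_at_id.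
have QPK p : eval_at Q (eval_at P p) = p.
  by rewrite eval_at_comp // (eq_eval_at QP) eval_at_id.
split.
- by move=> i; apply/tE; exists (P i).
- by move=> i j; rewrite /GRing.comm -!eval_atM // PC.
- by move=> i a; rewrite /GRing.comm -(eval_atC t a) -!eval_atM // PC.
- by move=> p; rewrite -eval_at_comp // => /tI Pp0; rewrite -[p]QPK Pp0 eval_at0.
- move=> b; rewrite tE; split=> -[p ->].
    by exists (eval_at Q p); rewrite -eval_at_comp // PQK.
  by exists (eval_at P p); rewrite eval_at_comp.
Qed.

Lemma alg_independent_drop_last (D : nzRingType) (n k : nat)
    (t : 'I_k.+1 -> {mpoly D[n]}) :
  (forall i x, GRing.comm x (t i)) -> alg_independent t ->
  alg_independent (drop_last t).
Proof.
move=> tC tI p.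
pose w := drop_last (fun i : 'I_k.+1 => 'X_i : {mpoly D[k.+1]}).
have -> : eval_at (drop_last t) p = eval_at t (eval_at w p).
  by rewrite eval_at_comp //; apply: eq_eval_at => i; rewrite eval_atX.
(* Sending the last variable to 0 and keeping the others gives a left inverse of the embedding
   [eval_at w]. *)
pose v (i : 'I_k.+1) : {mpoly D[k]} :=
  if unlift ord_max i is Some j then 'X_j else 0.
have vC i x : GRing.comm x (v i).
  rewrite /v; case: unliftP => [j _|_]; first exact: commr_mpolyX.
  exact: commr0.
move=> /tI wp0; rewrite -[p]eval_at_id -(eval_at0 v) -wp0 eval_at_comp //.
apply: eq_eval_at => i; rewrite eval_atX /v.
have -> : widen_ord (leq_pred k.+1) i = lift ord_max i.
  by apply: val_inj; rewrite /= /bump leqNgt ltn_ord.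
by rewrite liftK.
Qed.

Lemma change_of_variables_drop_last (D : nzRingType) (n k : nat)
    (S : {mpoly D[n]} -> Prop) (t : 'I_k.+1 -> {mpoly D[n]}) :
  change_of_variables S t ->
  change_of_variables (poly_subring (drop_last t)) (drop_last t).
Proof.
move=> tS; have tC := change_of_variables_central tS.
case: tS => _ tt tD tI _; split=> // [i|i j|i a|].
- by exists 'X_i; rewrite eval_atX.
- exact: tt.
- exact: tD.
- exact: alg_independent_drop_last.
Qed.

(** The boolean multiple fixes every index from [l] on. Taking [l] last serves (a); taking it next
    to last serves (b), where the last variable must stay. *)
Definition shear (R : nzRingType) (k : nat) (l : 'I_k) (e : nat -> nat)
    (t : 'I_k -> R) : 'I_k -> R :=
  fun i => t i - t l ^+ e i *+ (i < l).

Lemma eval_at_shear (D : nzRingType) (n k : nat) (l : 'I_k) (e : nat -> nat)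
    (t : 'I_k -> {mpoly D[n]}) i :
  (forall i x, GRing.comm x (t i)) ->
  eval_at t (shear l e (fun i => 'X_i) i) = shear l e t i.
Proof.
move=> tC; rewrite eval_atB eval_atX /shear; congr (_ - _).
by case: (i < l)%N; rewrite ?mulr0n ?eval_at0 // eval_atXn ?eval_atX.
Qed.

Lemma change_of_variables_shear (D : nzRingType) (n k : nat)
    (S : {mpoly D[n]} -> Prop) (t : 'I_k -> {mpoly D[n]}) (l : 'I_k)
    (e : nat -> nat) :
  change_of_variables S t -> change_of_variables S (shear l e t).
Proof.
move=> tS; have tC := change_of_variables_central tS.
pose P := shear l e (fun i => 'X_i : {mpoly D[k]}).
(* The inverse shear: both substitutions fix the variable of index [l], so adding its power back
   undoes the subtraction. *)
pose Q (i : 'I_k) : {mpoly D[k]} := 'X_i + 'X_l ^+ e i *+ (i < l).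
have PC i x : GRing.comm x (P i).
  apply: commrB; first exact: commr_mpolyX.
  by apply/commrMn/commrX/commr_mpolyX.
have QC i x : GRing.comm x (Q i).
  apply: commrD; first exact: commr_mpolyX.
  by apply/commrMn/commrX/commr_mpolyX.
have Pl : P l = 'X_l by rewrite /P /shear ltnn subr0.
have Ql : Q l = 'X_l by rewrite /Q ltnn addr0.
have PQ i : eval_at P (Q i) = 'X_i.
  rewrite eval_atD eval_atX {1}/P /shear; case: (i < l)%N; last first.
    by rewrite eval_at0 !mulr0n subr0 addr0.
  by rewrite eval_atXn // eval_atX Pl subrK.
have QP i : eval_at Q (P i) = 'X_i.
  by rewrite eval_at_shear // /shear Ql /Q addrK.
have [St tt tD tI tE] := change_of_variables_comp tS PC QC PQ QP.
have E i : eval_at t (P i) = shear l e t i by apply: eval_at_shear.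
split.
- by move=> i; rewrite -E.
- by move=> i j; rewrite -!E.
- by move=> i a; rewrite -E.
- by move=> p; rewrite -(eq_eval_at E); apply: tI.
- by move=> b; rewrite tE; split=> -[p ->]; exists p; rewrite (eq_eval_at E).
Qed.

(** * Degree bounds and monic elements over a subring *)

Definition is_subring (B : nzRingType) (S : B -> Prop) : Prop :=
  [/\ S 1, forall a b, S a -> S b -> S (a - b)
    & forall a b, S a -> S b -> S (a * b)].

Lemma poly_subring_is_subring (D : nzRingType) (n k : nat)
    (t : 'I_k -> {mpoly D[n]}) :
  (forall i x, GRing.comm x (t i)) -> is_subring (poly_subring t).
Proof.
move=> tC; split=> [|_ _ [p ->] [q ->]|_ _ [p ->] [q ->]].
- by exists 1; rewrite -mpolyC1 eval_atC.
- by exists (p - q); rewrite eval_atB.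
- by exists (p * q); rewrite eval_atM.
Qed.

(* The elements of S[y] of degree less than N in y. *)
Inductive deg_lt (B : nzRingType) (S : B -> Prop) (y : B) (N : nat) :
    B -> Prop :=
| DegLt0 : deg_lt S y N 0
| DegLtD j s b : (j < N)%N -> S s -> deg_lt S y N b ->
    deg_lt S y N (y ^+ j * s + b).

Lemma deg_lt_monom (B : nzRingType) (S : B -> Prop) (y : B) N j s :
  (j < N)%N -> S s -> deg_lt S y N (y ^+ j * s).
Proof. by move=> jN Ss; rewrite -[_ * _]addr0; do 2?constructor. Qed.

Lemma deg_ltD (B : nzRingType) (S : B -> Prop) (y : B) N a b :
  deg_lt S y N a -> deg_lt S y N b -> deg_lt S y N (a + b).
Proof.
move=> La Lb; elim: La => [|j s a' jN Ss _ IH]; first by rewrite add0r.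
by rewrite -addrA; constructor.
Qed.

Lemma deg_ltN (B : nzRingType) (S : B -> Prop) (y : B) N b :
  is_subring S -> deg_lt S y N b -> deg_lt S y N (- b).
Proof.
move=> [S1 SB _]; elim=> [|j s a jN Ss _ IH]; first by rewrite oppr0; constructor.
rewrite opprD -mulrN; constructor=> //.
have S0 : S 0 by rewrite -(subrr 1); apply: SB.
by rewrite -sub0r; apply: SB.
Qed.

Lemma deg_ltB (B : nzRingType) (S : B -> Prop) (y : B) N a b :
  is_subring S -> deg_lt S y N a -> deg_lt S y N b -> deg_lt S y N (a - b).
Proof. by move=> SS La Lb; apply: deg_ltD => //; apply: deg_ltN. Qed.

Lemma deg_ltW (B : nzRingType) (S : B -> Prop) (y : B) N N' b :
  (N <= N')%N -> deg_lt S y N b -> deg_lt S y N' b.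
Proof.
move=> NN'; elim=> [|j s a jN Ss _ IH]; constructor=> //.
exact: leq_trans NN'.
Qed.

(** The bounds are strict: exponents at most [N - 1] and [N' - 1] add up to less than [N + N' - 1].
    Centrality of [y] collects its powers on the left. *)
Lemma deg_ltM (B : nzRingType) (S : B -> Prop) (y : B) N N' a b :
  is_subring S -> (forall x, GRing.comm x y) ->
  deg_lt S y N a -> deg_lt S y N' b -> deg_lt S y (N + N').-1 (a * b).
Proof.
move=> [_ _ SM] yC La Lb; elim: La => [|j s a' jN Ss _ IH].
  by rewrite mul0r; constructor.
rewrite mulrDl; apply: deg_ltD => {IH} //.
elim: Lb => [|i s' b' iN Ss' _ IH]; first by rewrite mulr0; constructor.
rewrite mulrDr; apply: deg_ltD => //.
have -> : y ^+ j * s * (y ^+ i * s') = y ^+ (j + i) * (s * s').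
  by rewrite exprD -!mulrA; congr (_ * _); rewrite !mulrA (commrX i (yC s)).
apply: deg_lt_monom; last exact: SM.
lia.
Qed.

Lemma deg_lt_exp (B : nzRingType) (S : B -> Prop) (y : B) N j :
  is_subring S -> (j < N)%N -> deg_lt S y N (y ^+ j).
Proof. by case=> S1 _ _ jN; rewrite -[_ ^+ _]mulr1; apply: deg_lt_monom. Qed.

Lemma deg_lt_const (B : nzRingType) (S : B -> Prop) (y : B) s :
  S s -> deg_lt S y 1 s.
Proof. by move=> Ss; rewrite -[s]mul1r -(expr0 y); apply: deg_lt_monom. Qed.

Lemma deg_lt_split (B : nzRingType) (S : B -> Prop) (y : B) N b :
  is_subring S -> deg_lt S y N.+1 b ->
  exists2 s, S s & deg_lt S y N (b - y ^+ N * s).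
Proof.
move=> [S1 SB SM]; have S0 : S 0 by rewrite -(subrr 1); apply: SB.
elim=> [|j s a jN Ss _ [s' Ss' La]].
  by exists 0 => //; rewrite mulr0 subr0; constructor.
move: jN; rewrite ltnS leq_eqVlt => /orP [/eqP ->|jN].
  (* This is [s' + s], spelled with differences because [is_subring] states closure under
     subtraction. *)
  exists (s' - (0 - s)); first by apply: (SB) => //; apply: SB.
  by rewrite sub0r opprK mulrDr [y ^+ N * s' + _]addrC opprD addrACA subrr add0r.
by exists s' => //; rewrite -addrA; apply: DegLtD.
Qed.

Lemma deg_lt_coef (B : nzRingType) (S : B -> Prop) (y : B) N b :
  is_subring S -> deg_lt S y N b ->
  exists2 c : 'I_N -> B, forall j, S (c j) & b = \sum_(j < N) y ^+ j * c j.
Proof.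
move=> SS; elim: N b => [|N IH] b.
  case=> [|//]; exists (fun=> 1); last by rewrite big_ord0.
  by case: SS.
move=> /(deg_lt_split SS) [s Ss /IH [c Sc E]].
exists (fun i => if unlift ord_max i is Some j then c j else s).
  by move=> j; case: unliftP.
rewrite big_ord_recr /= unlift_none -[LHS](subrK (y ^+ N * s)) E.
congr (_ + _); apply: eq_bigr => j _.
have -> : widen_ord (leqnSn N) j = lift ord_max j.
  by apply: val_inj; rewrite /= /bump leqNgt ltn_ord.
by rewrite liftK.
Qed.

(** Expansions in powers of [y] are not claimed to be unique: [N] belongs to one presentation of [b]
    and is not an intrinsic degree. *)
Definition monic_of_deg (B : nzRingType) (S : B -> Prop) (y : B) (N : nat)
    (b : B) : Prop :=
  deg_lt S y N (b - y ^+ N).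

Lemma monic_of_deg_lt (B : nzRingType) (S : B -> Prop) (y : B) N b :
  is_subring S -> monic_of_deg S y N b -> deg_lt S y N.+1 b.
Proof.
move=> SS mb; rewrite -(subrK (y ^+ N) b).
by apply: deg_ltD; [apply: deg_ltW mb | apply: deg_lt_exp].
Qed.

Lemma monic_of_degM (B : nzRingType) (S : B -> Prop) (y : B) N N' a b :
  is_subring S -> (forall x, GRing.comm x y) ->
  monic_of_deg S y N a -> monic_of_deg S y N' b ->
  monic_of_deg S y (N + N') (a * b).
Proof.
move=> SS yC ma mb; rewrite /monic_of_deg.
have -> : a * b - y ^+ (N + N') =
    (a - y ^+ N) * b + y ^+ N * (b - y ^+ N').
  by rewrite mulrBl mulrBr exprD addrA subrK.
apply: deg_ltD.
  by apply: deg_ltW (deg_ltM SS yC ma (monic_of_deg_lt SS mb)); rewrite addnS.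
by apply: deg_ltW (deg_ltM SS yC (deg_lt_exp y SS (ltnSn N)) mb).
Qed.

Lemma monic_of_degX (B : nzRingType) (S : B -> Prop) (y : B) N b k :
  is_subring S -> (forall x, GRing.comm x y) ->
  monic_of_deg S y N b -> monic_of_deg S y (k * N) (b ^+ k).
Proof.
move=> SS yC mb; elim: k => [|k IH].
  by rewrite /monic_of_deg !expr0 subrr; constructor.
by rewrite exprS mulSn; apply: monic_of_degM.
Qed.

Lemma monic_of_deg_mmap1 (B : nzRingType) (S : B -> Prop) (y : B) k
    (t : 'I_k -> B) (e : 'I_k -> nat) (m : 'X_{1..k}) :
  is_subring S -> (forall x, GRing.comm x y) ->
  (forall i, monic_of_deg S y (e i) (t i)) ->
  monic_of_deg S y (\sum_(i < k) m i * e i)%N (mmap1 t m).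
Proof.
move=> SS yC te; rewrite /mmap1.
elim/big_rec2: _ => [|i N b _ IH].
  by rewrite /monic_of_deg !expr0 subrr; constructor.
by apply: monic_of_degM => //; apply: monic_of_degX.
Qed.

(** * Right modules and division by a monic annihilator *)

Lemma ractB (B : nzRingType) (M : lmodType B^c) (g : M) (a b : B) :
  ract g (a - b) = ract g a - ract g b.
Proof. exact: scalerBl. Qed.

Lemma ractM (B : nzRingType) (M : lmodType B^c) (g : M) (a b : B) :
  ract g (a * b) = ract (ract g a) b.
Proof. by rewrite /ract scalerA. Qed.

(** Subtracting [u * (y ^+ (K - N) * s)] cancels the term of degree [K] in [b] and leaves [ract g b]
    unchanged, since [u] stands on the left and so acts first. *)
Lemma ract_monic_reduce (B : nzRingType) (M : lmodType B^c) (S : B -> Prop)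
    (y : B) (N : nat) (u : B) (g : M) :
  is_subring S -> (forall x, GRing.comm x y) ->
  monic_of_deg S y N u -> ract g u = 0 ->
  forall K b, deg_lt S y K b ->
  exists2 b', deg_lt S y N b' & ract g b = ract g b'.
Proof.
move=> SS yC mu gu; elim=> [|K IH] b Lb; first by exists b => //; apply: deg_ltW Lb.
have [KN|NK] := ltnP K N; first by exists b => //; apply: deg_ltW Lb.
have [s Ss Ls] := deg_lt_split SS Lb.
have [|b' Lb' E] := IH (b - u * (y ^+ (K - N) * s)); last first.
  by exists b' => //; rewrite -E ractB ractM gu /ract scaler0 subr0.
have -> : b - u * (y ^+ (K - N) * s) =
    (b - y ^+ K * s) - (u - y ^+ N) * (y ^+ (K - N) * s).
  by rewrite mulrBl (mulrA (y ^+ N)) -exprD subnKC // opprB addrA subrK.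
apply: deg_ltB => //.
have := deg_ltM SS yC mu (deg_lt_monom y (ltnSn (K - N)) Ss).
by apply: deg_ltW; rewrite addnS subnKC.
Qed.

Lemma fin_gen_over_finType (B : nzRingType) (M : lmodType B^c)
    (S : B -> Prop) (I : finType) (g : I -> M) :
  (forall y : M, exists2 c : I -> B, forall i, S (c i)
                                   & y = \sum_i ract (g i) (c i)) ->
  fin_gen_over M S.
Proof.
move=> gP; exists #|I|, (fun i => g (enum_val i)) => y.
have [c Sc ->] := gP y; exists (fun i => c (enum_val i)) => //.
rewrite (reindex (fun j : 'I_#|I| => enum_val j)) //.
exact/onW_bij/enum_val_bij.
Qed.

(** The digit at [ord_max] has weight 1, so it is the remainder modulo [r]; removing it and dividing
    by [r] leaves a shorter expansion. *)
Lemma radix_inj (r k : nat) (F G : 'I_k -> nat) :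
  (forall i, F i < r)%N -> (forall i, G i < r)%N ->
  (\sum_(i < k) F i * r ^ (k - i.+1) = \sum_(i < k) G i * r ^ (k - i.+1))%N ->
  F =1 G.
Proof.
elim: k F G => [|k IH] F G Fr Gr; first by move=> _ [].
have step (H : 'I_k.+1 -> nat) :
    (\sum_(i < k.+1) H i * r ^ (k.+1 - i.+1) =
     (\sum_(i < k) H (widen_ord (leqnSn k) i) * r ^ (k - i.+1)) * r
       + H ord_max)%N.
  rewrite big_ord_recr /= subnn expn0 muln1; congr (_ + _)%N.
  rewrite big_distrl; apply: eq_bigr => i _ /=.
  by rewrite -mulnA -expnSr subSS subnSK.
rewrite !step => E.
have r0 : (0 < r)%N by apply: leq_trans (Fr ord_max).
have Em : F ord_max = G ord_max.
  by move: (congr1 (modn^~ r) E); rewrite !modnMDl !modn_small.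
have Ew : (fun i => F (widen_ord (leqnSn k) i)) =1
          (fun i => G (widen_ord (leqnSn k) i)).
  apply: IH => // ; move: E; rewrite Em => /addIn /eqP.
  by rewrite eqn_pmul2r // => /eqP.
move=> i; have [ik|ki] := ltnP i k.
  have := Ew (Ordinal ik); rewrite (_ : widen_ord _ _ = i) //.
  exact: val_inj.
have -> // : i = ord_max.
by apply: val_inj; apply/eqP; rewrite eqn_leq /= -ltnS ltn_ord.
Qed.

Lemma exists_max_seq (T : eqType) (f : T -> nat) (s : seq T) :
  s != [::] -> exists2 x, x \in s & forall y, y \in s -> (f y <= f x)%N.
Proof.
elim: s => [//|a s IH] _; case: (eqVneq s [::]) => [->|/IH [x xs xM]].
  by exists a => [|y]; rewrite ?inE // => /eqP ->.
have [ax|xa] := leqP (f a) (f x).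
  exists x => [|y]; rewrite inE ?xs ?orbT //.
  by case/predU1P=> [->|/xM].
exists a => [|y]; rewrite inE ?eqxx //.
by case/predU1P=> [->|/xM yx] //; apply: leq_trans yx (ltnW xa).
Qed.

(** * Finite generation over one variable fewer *)

Lemma fin_gen_over_shear (D : unitRingType) (hD : division_ring D) (n m : nat)
    (M : lmodType {mpoly D[n]}^c) (t : 'I_m.+1 -> {mpoly D[n]}) :
  (forall i x, GRing.comm x (t i)) ->
  fin_gen_over M (poly_subring t) -> torsion_over M (poly_subring t) ->
  exists e : nat -> nat,
    fin_gen_over M (poly_subring (drop_last (shear ord_max e t))).
Proof.
move=> tC [k [g gP]] Mt.
have /fin_all_exists2 [p p0 gp] (i : 'I_k) :
    exists2 p : {mpoly D[m.+1]}, p != 0 & ract (g i) (eval_at t p) = 0.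
  have [d [[p ->] dreg _] gd] := Mt (g i); exists p => //.
  (* If [p] were 0, the regular element would be 0, and regularity tested on 1 would give 1 = 0. *)
  apply/eqP => p0; have /eqP := oner_neq0 {mpoly D[n]}; apply.
  apply: dreg; last by rewrite p0 eval_at0 mul0r.
  by exists 1; rewrite -mpolyC1 eval_atC.
(* [msize] exceeds the total degree of a nonzero polynomial, so [r] exceeds all exponents in all
   [p i]; the successor keeps [r] positive when [k] is 0. *)
pose r := (\max_i msize (p i)).+1.
pose e j := (r ^ (m.+1 - j.+1))%N; exists e.
set z := shear _ _ _; set S := poly_subring _; pose y := t ord_max.
have zC i x : GRing.comm x (z i).
  by apply: commrB => //; apply/commrMn/commrX.
have SS : is_subring S by apply: poly_subring_is_subring => i; apply: zC.
have SC a : S a%:MP by exists a%:MP; rewrite eval_atC.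
have yC x : GRing.comm x y by apply: tC.
have t_monic (i : 'I_m.+1) : monic_of_deg S y (e i) (t i).
  (* For [i < m] the difference is the new variable [z i] itself, a constant in [S], while [e i] is
     positive. At the last index the weight is 1 and the difference is 0. *)
  rewrite /monic_of_deg; have [im|mi] := ltnP i m.
    apply: (@deg_ltW _ _ _ 1); first by rewrite expn_gt0.
    apply: deg_lt_const; exists ('X_(Ordinal im)); rewrite eval_atX.
    rewrite /drop_last (_ : widen_ord _ _ = i) ?/z ?/shear ?im //.
    exact: val_inj.
  have -> : i = ord_max.
    by apply: val_inj; apply/eqP; rewrite eqn_leq /= -ltnS ltn_ord.
  by rewrite /e subnn expn0 expr1 subrr; constructor.
pose w (a : 'X_{1..m.+1}) := (\sum_(i < m.+1) a i * e i)%N.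
have mon_monic a : monic_of_deg S y (w a) (mmap1 t a).
  exact: (monic_of_deg_mmap1 (e := fun i : 'I_m.+1 => e i)).
have mon_deg c a N : (w a < N)%N -> deg_lt S y N (c%:MP * mmap1 t a).
  move=> aN; apply: deg_ltW aN _; apply: (deg_ltM (N := 1)) => //.
    exact: deg_lt_const.
  exact: monic_of_deg_lt.
have /fin_all_exists [N /fin_all_exists2 [u u_monic gu]] (i : 'I_k) :
    exists N, exists2 u, monic_of_deg S y N u & ract (g i) u = 0.
  (* The dominant monomial: its weight will be the degree in [y]. *)
  have [|a ap aM] := @exists_max_seq _ w (msupp (p i)).
    by rewrite msupp_eq0.
  pose c := (p i)@_a; have cU : c \is a GRing.unit.
    by apply: hD; rewrite -mcoeff_msupp.
  (* Normalizing on the right preserves annihilation: [g i] is already killed before [c^-1] acts. *)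
  exists (w a), (eval_at t (p i) * (c^-1)%:MP); last first.
    by rewrite ractM gp /ract scaler0.
  rewrite /monic_of_deg.
  have -> : eval_at t (p i) * (c^-1)%:MP - y ^+ w a =
      (eval_at t (p i) - c%:MP * y ^+ w a) * (c^-1)%:MP.
    rewrite mulrBl; congr (_ - _).
    by rewrite (commrX _ (yC _)) -mulrA -mpolyCM mulrV // mulr1.
  apply: (deg_ltW (N := (w a + 1).-1)); first by rewrite addn1.
  apply: deg_ltM => //; last exact: deg_lt_const.
  rewrite /eval_at /mmap (bigD1_seq a) ?msupp_uniq //= addrAC -mulrBr.
  apply: deg_ltD.
    by apply: (deg_ltM (N := 1)) (mon_monic a) => //; apply: deg_lt_const.
  rewrite big_seq_cond; apply: (big_ind (deg_lt S y (w a))).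
  - by constructor.
  - exact: deg_ltD.
  move=> b /andP [bp ba]; apply: mon_deg.
  (* Equal weights would mean equal base [r] digits, hence [b = a]; so every other monomial is
     strictly lower. *)
  rewrite ltn_neqAle aM // andbT; apply: contra ba => /eqP wba.
  have bnd q : q \in msupp (p i) -> forall j, (q j < r)%N.
    move=> /msize_mdeg_lt qp j; rewrite ltnS.
    apply: leq_trans (leq_bigmax i); apply: leq_trans (ltnW qp).
    by rewrite mdegE (bigD1 j) //= leq_addr.
  by apply/eqP/mnmP; apply: radix_inj wba; apply: bnd.
(* A common bound, so that the new generators are indexed by a product of ordinals. *)
pose N' := \max_i N i.
have red (i : 'I_k) b : poly_subring t b ->
    exists2 c : 'I_N' -> {mpoly D[n]}, forall j, S (c j)
      & ract (g i) b = \sum_(j < N') ract (g i) (y ^+ j * c j).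
  move=> [q ->].
  have [K LK] : exists K, deg_lt S y K (eval_at t q).
    apply: (big_ind (fun b => exists K, deg_lt S y K b)).
    - by exists 0%N; constructor.
    - move=> a1 a2 [K1 L1] [K2 L2]; exists (K1 + K2)%N.
      by apply: deg_ltD; [apply: deg_ltW L1; rewrite leq_addr
                         |apply: deg_ltW L2; rewrite leq_addl].
    - by move=> a _; exists (w a).+1; apply: mon_deg.
  have [b' Lb' ->] := ract_monic_reduce SS yC (u_monic i) (gu i) LK.
  have [c Sc ->] := deg_lt_coef SS (deg_ltW (leq_bigmax i) Lb').
  by exists c => //; rewrite /ract scaler_suml.
apply: (@fin_gen_over_finType _ _ _ ('I_k * 'I_N')%type
          (fun ij => ract (g ij.1) (y ^+ val ij.2))) => x.
have [c Sc ->] := gP x.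
have /fin_all_exists2 [c' Sc' cc'] (i : 'I_k) := red i _ (Sc i).
exists (fun ij => c' ij.1 ij.2) => [[i j]|]; first exact: Sc'.
rewrite -(pair_bigA _ (fun i j => ract (ract (g i) (y ^+ val j)) (c' i j))) /=.
by apply: eq_bigr => i _; rewrite cc'; apply: eq_bigr => j _; rewrite ractM.
Qed.

Theorem mainTheorem2 (D : unitRingType) (hD : division_ring D) (n : nat)
    (M : lmodType {mpoly D[n]}^c)
    (M_fg : fin_gen_over M (whole_ring {mpoly D[n]}))
    (M_tors : torsion_over M (whole_ring {mpoly D[n]})) :
  (* (a) *)
  (exists t : 'I_n -> {mpoly D[n]},
     change_of_variables (whole_ring {mpoly D[n]}) t
     /\ fin_gen_over M (poly_subring (drop_last t)))
  /\
  (* (b), for every t as in (a) *)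
  (forall t : 'I_n -> {mpoly D[n]},
     (2 <= n)%N ->
     change_of_variables (whole_ring {mpoly D[n]}) t ->
     fin_gen_over M (poly_subring (drop_last t)) ->
     torsion_over M (poly_subring (drop_last t)) ->
     exists z : 'I_n -> {mpoly D[n]},
       [/\ change_of_variables (poly_subring (drop_last t)) (drop_last z),
           fin_gen_over M (poly_subring (drop_last (drop_last z))),
           change_of_variables (whole_ring {mpoly D[n]}) z
         & forall i : 'I_n, i = n.-1 :> nat -> z i = t i]).
Proof.
split.
  case: n M M_fg M_tors => [|m] M M_fg M_tors.
    (* For [n = 0] the truncated predecessor is again 0, so [drop_last] removes nothing and the
       subring is all of [B]. *)
    exists (fun i => 'X_i); split; first exact: change_of_variables_id.
    have [k [g gP]] := M_fg; exists k, g => y; have [c _ ->] := gP y.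
    exists c => // i; exists (c i).
    by rewrite -[LHS]eval_at_id; apply: eq_eval_at => -[].
  have XS := change_of_variables_id D m.+1.
  have XW b : whole_ring {mpoly D[m.+1]} b <-> poly_subring (fun i => 'X_i) b.
    by case: XS.
  have [] := @fin_gen_over_shear D hD m.+1 m M (fun i => 'X_i).
  - exact: change_of_variables_central XS.
  - have [k [g gP]] := M_fg; exists k, g => y; have [c Sc ->] := gP y.
    by exists c => // i; apply/XW.
  - move=> y; have [d [_ d1 d2] yd] := M_tors y; exists d => //.
    by split=> [|b _|b _]; [exact/XW | exact: d1 | exact: d2].
  by move=> e Me; exists (shear ord_max e (fun i => 'X_i)); split=> //;
     exact: change_of_variables_shear.
case: n M M_fg M_tors => [|[|m]] // M M_fg M_tors t _ tS Mt_fg Mt_tors.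
have tC := change_of_variables_central tS.
have [|e Me] := @fin_gen_over_shear D hD m.+2 m M (drop_last t) _ Mt_fg Mt_tors.
  by move=> i; apply: tC.
(* With [l] next to last, [drop_last (shear l e t)] is convertible to
   [shear ord_max e (drop_last t)], so one shear of [t] serves both rings. *)
pose l : 'I_m.+2 := widen_ord (leq_pred m.+2) (ord_max : 'I_m.+1).
exists (shear l e t); split.
- exact: (change_of_variables_shear (ord_max : 'I_m.+1) e
            (change_of_variables_drop_last tS)).
- exact: Me.
- exact: change_of_variables_shear.
- by move=> i im; rewrite /shear im /= ltnNge leqnSn subr0.
Qed.
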